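(* For every morphism of Lie algebras $\phi:\mathfrak g\to\mathfrak h$ there is a canonically associated structure of formal $\mathfrak g$-homogeneous space on $\mathfrak h$, that is, a morphism of Lie algebras $F_\phi:\mathfrak g\to\mathcal T_{\mathfrak h}$, given in bases $\{e_a\}$ of $\mathfrak g$ and $\{e_\alpha\}$ of $\mathfrak h$ by $$F_\phi(e_a)=\sum_{n\ge0}\frac{B_n}{n!}\,\phi_a^{\gamma_1}C_{\gamma_1\beta_1}^{\gamma_2}C_{\gamma_2\beta_2}^{\gamma_3}\cdots C_{\gamma_n\beta_n}^{\alpha}\,t^{\beta_1}t^{\beta_2}\cdots t^{\beta_n}\frac{\partial}{\partial t^\alpha}$$ (summation over repeated indices; the $n=0$ term is $\phi_a^\alpha\,\partial/\partial t^\alpha$), where $[e_\alpha,e_\beta]=\sum_\gamma C_{\alpha\beta}^\gamma e_\gamma$ in $\mathfrak h$, $\phi(e_a)=\sum_\alpha\phi_a^\alpha e_\alpha$, $\{t^\alpha\}$ is the dual basis in $\mathfrak h^*$, and $B_n$ are the Bernoulli numbers, $\sum_{n\ge0}\frac{B_n}{n!}z^n=\frac{z}{e^z-1}$.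
   Context: $\mathbb K$ is a field of characteristic zero. $\mathcal T_{\mathfrak h}$ is the Lie algebra of smooth formal vector fields on the vector space $\mathfrak h$, i.e. derivations of the ring of formal power series $\prod_{n\ge0}\odot^n\mathfrak h^*$; a formal vector field $V=\sum_\alpha V^\alpha(t)\frac{\partial}{\partial t^\alpha}$ is determined by its Taylor components in $\mathrm{Hom}(\odot^n\mathfrak h,\mathfrak h)$, $n\ge0$, and the bracket is the commutator of derivations, $[V,W]^\alpha=\sum_\beta\big(V^\beta\partial_\beta W^\alpha-W^\beta\partial_\beta V^\alpha\big)$. A formal homogeneous space is a triple $(\mathfrak g,\mathfrak h,F)$ with $\mathfrak g$ a Lie algebra, $\mathfrak h$ a vector space and $F:\mathfrak g\to\mathcal T_{\mathfrak h}$ a morphism of Lie algebras. *)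

(* Defs.v *)
From HB Require Import structures.
From mathcomp Require Import all_boot all_order all_algebra.
From mathcomp Require Import boolp classical_sets functions cardinality fsbigop.

Set Implicit Arguments.
Unset Strict Implicit.
Unset Printing Implicit Defensive.

Import GRing.Theory Num.Theory.
Local Open Scope ring_scope.

HB.mixin Record Lmodule_isLieAlgebra (K : fieldType) L of GRing.Lmodule K L := {
  lie : L -> L -> L;
  lie_linearl : forall y, linear (fun x => lie x y);
  lie_linearr : forall x, linear (lie x);
  liexx : forall x, lie x x = 0;
  lie_jacobi : forall x y z,
    lie x (lie y z) + lie y (lie z x) + lie z (lie x y) = 0
}.

#[short(type="lieAlgType")]
HB.structure Definition LieAlgebra (K : fieldType) :=
  {L of GRing.Lmodule K L & Lmodule_isLieAlgebra K L}.

Record lie_hom (K : fieldType) (g h : lieAlgType K) := LieHom {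
  lie_hom_fun :> g -> h;
  lie_hom_linear : linear lie_hom_fun;
  lie_hom_lie : {morph lie_hom_fun : x y / lie x y}
}.

(* A Hamel basis of V, possibly infinite, together with its dual basis
   (the coordinate functions). *)
Record basis (K : fieldType) (V : lmodType K) (I : choiceType) := Basis {
  bvec :> I -> V;
  dual : I -> V -> K^o;
  dual_linear : forall i, linear (dual i);
  dual_bvec : forall i j, dual i (bvec j) = (i == j)%:R;
  dual_finite : forall v, finite_set [set i | dual i v != 0]%classic;
  dual_span : forall v, v = \sum_(i \in [set: I]) dual i v *: bvec i
}.

(* bernoulli_egf n = B_n / n!, the coefficients of the inverse of
   (e^z - 1) / z = \sum_n z^n / (n + 1)!. *)
Fixpoint bernoulli_egf_seq (n : nat) : seq rat :=
  if n is m.+1 then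
    let b := bernoulli_egf_seq m in
    rcons b ((m == 0)%:R - \sum_(k < m) b`_k / ((m - k).+1)`!%:R)
  else [::].

Definition bernoulli_egf (n : nat) : rat := (bernoulli_egf_seq n.+1)`_n.

Definition bernoulli (n : nat) : rat := n`!%:R * bernoulli_egf n.

Lemma size_bernoulli_egf_seq n : size (bernoulli_egf_seq n) = n.
Proof. by elim: n => //= n IH; rewrite size_rcons IH. Qed.

Lemma nth_bernoulli_egf_seq n k : (k < n)%N ->
  (bernoulli_egf_seq n)`_k = bernoulli_egf k.
Proof.
elim: n => // n IH; rewrite ltnS leq_eqVlt => /orP[/eqP -> //|lt_kn].
by rewrite /= nth_rcons size_bernoulli_egf_seq lt_kn IH.
Qed.

(* (\sum_n B_n / n! z^n) (e^z - 1) = z *)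
Lemma bernoulli_generating n :
  \sum_(k < n.+1) bernoulli k / k`!%:R * ((k < n)%:R / (n - k)`!%:R)
  = (n == 1)%:R.
Proof.
have B k : bernoulli k / k`!%:R = bernoulli_egf k.
  rewrite /bernoulli mulrAC divff ?mul1r // pnatr_eq0 -lt0n; exact: fact_gt0.
under eq_bigr do rewrite B.
case: n => [|n]; first by rewrite big_ord1 /= mul0r mulr0.
rewrite big_ord_recr /= ltnn mul0r mulr0 addr0 big_ord_recr /=.
rewrite ltnSn subSnn [true%:R / _]divr1 mulr1.
rewrite [X in _ + X]/bernoulli_egf [bernoulli_egf_seq n.+1]/= nth_rcons.
rewrite size_bernoulli_egf_seq ltnn eqxx addrC.
under [X in _ - X]eq_bigr do rewrite nth_bernoulli_egf_seq //.
rewrite eqSS -[RHS](subrK (\sum_(k < n) bernoulli_egf k / ((n - k).+1)`!%:R)).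
congr (_ + _); apply: eq_bigr => k _.
by rewrite ltnS ltnW // subSn ?mul1r // ltnW.
Qed.

Section FormalMaps.
Variables (K : fieldType) (h : lmodType K).

(* A formal map f from h to W, i.e. an element of \prod_n Hom(S^n h, W), is
   encoded by its Taylor coefficients at the origin: f [:: t_1; ...; t_n] is the
   iterated derivative of f at 0 along t_1, ..., t_n. The homogeneous part of
   degree n is t |-> f (nseq n t) / n!. By symmetry, linearity in the first
   argument is linearity in each argument. *)
Definition symmetric_multilinear (W : lmodType K) (f : seq h -> W) : Prop :=
  (forall s s', perm_eq s s' -> f s = f s') /\
  (forall s, linear (fun v => f (v :: s))).

Definition symmetric_multilinear_pred (W : lmodType K) : pred (seq h -> W) :=
  fun f => `[< symmetric_multilinear f >].

Record formal_map (W : lmodType K) := FormalMap {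
  taylor :> seq h -> W;
  taylorP : taylor \in @symmetric_multilinear_pred W
}.

Lemma symmetric_multilinear_submod (W : lmodType K) :
  submod_closed (@symmetric_multilinear_pred W).
Proof.
split=> [|a f g /asboolP[fS fL] /asboolP[gS gL]]; apply/asboolP.
  split=> // s a u v; by rewrite scaler0 addr0.
split=> [s s' ss'|s c u v]; rewrite !fctE /=; first by rewrite (fS _ _ ss') (gS _ _ ss').
rewrite fL gL !scalerDr !scalerA mulrC -!addrA; congr (_ + _).
by rewrite addrCA.
Qed.

HB.instance Definition _ (W : lmodType K) :=
  GRing.isSubmodClosed.Build K (seq h -> W) (@symmetric_multilinear_pred W)
    (symmetric_multilinear_submod W).

HB.instance Definition _ (W : lmodType K) := [isSub for @taylor W].
HB.instance Definition _ (W : lmodType K) := [Choice of formal_map W by <:].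
HB.instance Definition _ (W : lmodType K) :=
  [SubChoice_isSubLmodule of formal_map W by <:].


(* The 2 ^ (size s) ways of distributing the entries of s over two sequences. *)
Fixpoint splits (s : seq h) : seq (seq h * seq h) :=
  if s is v :: s' then
    [seq (v :: p.1, p.2) | p <- splits s'] ++
    [seq (p.1, v :: p.2) | p <- splits s']
  else [:: ([::], [::])].

(* The iterated Leibniz rule: the derivatives at 0 of t |-> b (f t) (g t). *)
Definition leibniz (U W : Type) (Z : lmodType K) (b : U -> W -> Z)
    (f : seq h -> U) (g : seq h -> W) (s : seq h) : Z :=
  \sum_(p <- splits s) b (f p.1) (g p.2).

Definition pder (U : Type) (v : h) (f : seq h -> U) : seq h -> U :=
  fun s => f (v :: s).

Definition sym (U : Type) (f : seq h -> U) :=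
  forall s s', perm_eq s s' -> f s = f s'.

Lemma leibniz_nil U W (Z : lmodType K) (b : U -> W -> Z) f g :
  leibniz b f g [::] = b (f [::]) (g [::]).
Proof. by rewrite /leibniz /= big_seq1. Qed.

Lemma leibniz_cons U W (Z : lmodType K) (b : U -> W -> Z) f g v s :
  leibniz b f g (v :: s) = leibniz b (pder v f) g s + leibniz b f (pder v g) s.
Proof. by rewrite /leibniz /= big_cat !big_map. Qed.

Lemma sym_pder U v (f : seq h -> U) : sym f -> sym (pder v f).
Proof. by move=> fS s s' ss'; apply: fS; rewrite perm_cons. Qed.

Lemma pderC U v w (f : seq h -> U) : sym f -> pder v (pder w f) = pder w (pder v f).
Proof.
move=> fS; apply/funext => s; apply: fS.
by rewrite (perm_catCA [:: w] [:: v]).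
Qed.

Lemma sym_leibniz U W (Z : lmodType K) (b : U -> W -> Z) f g :
  sym f -> sym g -> sym (leibniz b f g).
Proof.
have move_front s1 v s2 : forall f g, sym f -> sym g ->
    leibniz b f g (s1 ++ v :: s2) = leibniz b f g (v :: s1 ++ s2).
  elim: s1 => // w s1 IH f0 g0 fS gS.
  rewrite cat_cons leibniz_cons !IH; try by [|apply: sym_pder].
  rewrite !leibniz_cons (pderC _ _ fS) (pderC _ _ gS) !addrA; congr (_ + _).
  by rewrite addrAC.
move=> fS gS s; elim: s f g fS gS => [|v s IH] f g fS gS s'.
  by rewrite perm_sym => /perm_nilP ->.
move=> ss'; have vs' : v \in s' by rewrite -(perm_mem ss') mem_head.
move: ss'; case/splitPr: vs' => s1 s2.
rewrite perm_sym -[v :: s2]cat1s perm_catCA /= perm_cons perm_sym => ss'.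
rewrite move_front // !leibniz_cons.
by congr (_ + _); apply: IH => //; apply: sym_pder.
Qed.

Lemma leibniz_linearl (U W Z : lmodType K) (b : U -> W -> Z) a f1 f2 g s :
  (forall r, linear (fun u => b u (g r))) ->
  leibniz b (fun r => a *: f1 r + f2 r) g s
  = a *: leibniz b f1 g s + leibniz b f2 g s.
Proof.
move=> bL; rewrite /leibniz scaler_sumr -big_split; apply: eq_bigr => p _.
exact: bL.
Qed.

Lemma leibniz_linearr U (W Z : lmodType K) (b : U -> W -> Z) a f g1 g2 s :
  (forall u, linear (b u)) ->
  leibniz b f (fun r => a *: g1 r + g2 r) s
  = a *: leibniz b f g1 s + leibniz b f g2 s.
Proof.
move=> bL; rewrite /leibniz scaler_sumr -big_split; apply: eq_bigr => p _.
exact: bL.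
Qed.

Lemma eq_leibniz U W (Z : lmodType K) (b : U -> W -> Z) f1 f2 g1 g2 s :
  f1 =1 f2 -> g1 =1 g2 -> leibniz b f1 g1 s = leibniz b f2 g2 s.
Proof. by move=> /funext -> /funext ->. Qed.

Definition formal_function := formal_map K^o.

HB.instance Definition _ := GRing.Lmodule.on formal_function.

Lemma formal_mapP (W : lmodType K) (f g : formal_map W) : f =1 g -> f = g.
Proof. by move=> fg; apply/val_inj/funext. Qed.

Lemma formal_map_sym (W : lmodType K) (f : formal_map W) : sym f.
Proof. by have /asboolP[] := taylorP f. Qed.

Lemma formal_map_linear (W : lmodType K) (f : formal_map W) s :
  linear (fun v => f (v :: s)).
Proof. by have /asboolP[_] := taylorP f. Qed.

Definition rawmul : (seq h -> K^o) -> (seq h -> K^o) -> seq h -> K^o :=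
  leibniz (Z := K^o) (fun x y : K => x * y).

Lemma rawmulDl f1 f2 g s : rawmul (f1 \+ f2) g s = rawmul f1 g s + rawmul f2 g s.
Proof.
by rewrite /rawmul /leibniz -big_split; apply: eq_bigr => p _; rewrite mulrDl.
Qed.

Lemma rawmulC f g : rawmul f g = rawmul g f.
Proof.
apply/funext => s; rewrite /rawmul; elim: s f g => [|v s IH] f g.
  by rewrite !leibniz_nil mulrC.
by rewrite !leibniz_cons addrC; congr (_ + _).
Qed.

Lemma rawmulDr f g1 g2 s : rawmul f (g1 \+ g2) s = rawmul f g1 s + rawmul f g2 s.
Proof. by rewrite !(rawmulC f) rawmulDl. Qed.

Lemma pder_rawmul v f g :
  pder v (rawmul f g) = rawmul (pder v f) g \+ rawmul f (pder v g).
Proof. by apply/funext => s; rewrite /pder /rawmul leibniz_cons. Qed.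

Lemma rawmulA f g k : rawmul f (rawmul g k) = rawmul (rawmul f g) k.
Proof.
apply/funext => s; elim: s f g k => [|v s IH] f g k.
  by rewrite /rawmul !leibniz_nil mulrA.
rewrite -[LHS]/(pder v _ s) -[RHS]/(pder v _ s) !pder_rawmul /=.
rewrite rawmulDl rawmulDr !IH.
by rewrite addrA.
Qed.

Lemma mulf_subproof (f g : formal_function) :
  rawmul f g \in @symmetric_multilinear_pred K^o.
Proof.
apply/asboolP; split=> [|s a u v].
  by apply: sym_leibniz; [exact: (formal_map_sym f)|exact: (formal_map_sym g)].
rewrite /rawmul !leibniz_cons.
rewrite (@eq_leibniz _ _ _ _ (pder _ f) (fun r => a *: pder u f r + pder v f r) g g) //;
  last by move=> r; apply: formal_map_linear.
rewrite (@eq_leibniz _ _ _ _ f f (pder _ g) (fun r => a *: pder u g r + pder v g r)) //;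
  last by move=> r; apply: formal_map_linear.
rewrite leibniz_linearl; last by move=> r c x y; rewrite mulrDl -[c *: x]/(c * x) -mulrA.
rewrite leibniz_linearr; last by move=> r c x y; rewrite mulrDr -[c *: x]/(c * x) mulrCA.
by rewrite !scalerDr -!addrA; congr (_ + _); rewrite addrCA.
Qed.

Definition mulf (f g : formal_function) : formal_function :=
  FormalMap (mulf_subproof f g).

Lemma onef_subproof :
  (fun s : seq h => (s == [::])%:R) \in @symmetric_multilinear_pred K^o.
Proof.
apply/asboolP; split=> [s s' /perm_size|s a u v]; last by rewrite scaler0 addr0.
by case: s; case: s'.
Qed.

Definition onef : formal_function := FormalMap onef_subproof.

Lemma mulfA : associative mulf.
Proof. by move=> f g k; apply: val_inj; apply: rawmulA. Qed.

Lemma mulfC : commutative mulf.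
Proof. by move=> f g; apply: val_inj; apply: rawmulC. Qed.

Lemma mul1f : left_id onef mulf.
Proof.
move=> f; apply: val_inj => /=; apply/funext => s.
elim: s (taylor f) => [|v s IH] {}f; first by rewrite /rawmul leibniz_nil mul1r.
rewrite -[LHS]/(pder v _ s) pder_rawmul /= IH.
rewrite (_ : rawmul _ f s = 0) ?add0r // /rawmul /leibniz big1 // => p _.
by rewrite /pder mul0r.
Qed.

Lemma mulfDl : left_distributive mulf +%R.
Proof. by move=> f g k; apply: formal_mapP => s; apply: rawmulDl. Qed.

Lemma onef_neq0 : onef != 0.
Proof.
apply/eqP => /(congr1 (fun f : formal_function => f [::])) /eqP.
by rewrite /= oner_eq0.
Qed.

HB.instance Definition _ :=
  GRing.Zmodule_isComNzRing.Build formal_function mulfA mulfC mul1f mulfDl onef_neq0.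

Definition homogeneous_part (f : formal_function) (n : nat) (t : h) : K :=
  f (nseq n t) / n`!%:R.

Lemma rawmul_nseq f g n t :
  rawmul f g (nseq n t) =
  \sum_(i < n.+1) 'C(n, i)%:R * (f (nseq i t) * g (nseq (n - i) t)).
Proof.
elim: n f g => [|n IH] f g; first by rewrite /rawmul leibniz_nil big_ord1 mul1r.
rewrite -[LHS]/(pder t _ _) pder_rawmul /= !IH /pder.
rewrite [RHS]big_ord_recl [X in _ = _ + X]/=.
have binE i : ('C(n.+1, bump 0 i))%:R = ('C(n, i))%:R + ('C(n, i.+1))%:R :> K.
  by rewrite /bump add1n binS natrD addrC.
under [X in _ = _ + X]eq_bigr do rewrite binE mulrDl.
rewrite big_split /= [RHS]addrCA; congr (_ + _).
rewrite [X in _ = _ + X]big_ord_recr /= (@bin_small n n.+1) // mul0r addr0 big_ord_recl.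
rewrite subn0 !bin0.
congr (_ + _); apply: eq_bigr => i _; rewrite /bump !add1n subSS.
by rewrite -[t :: nseq (n - i.+1) t]/(nseq (n - i.+1).+1 t) -subSn // subSS.

Qed.
(* In characteristic zero the ring of formal functions is the ring of formal
   power series: products of homogeneous parts are computed pointwise. *)
Lemma homogeneous_partM (f g : formal_function) n t : [pchar K] =i pred0 ->
  homogeneous_part (f * g) n t =
  \sum_(i < n.+1) homogeneous_part f i t * homogeneous_part g (n - i) t.
Proof.
move=> /pcharf0P charK; have fact_neq0 m : m`!%:R != 0 :> K.
  by rewrite charK -lt0n fact_gt0.
rewrite /homogeneous_part -[(f * g) _]/(rawmul f g _) rawmul_nseq mulr_suml.
apply: eq_bigr => i _; have le_in : (i <= n)%N by rewrite -ltnS.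
rewrite mulrACA -invfM [LHS]mulrAC [LHS]mulrC; congr (_ * _).
apply: (mulIf (fact_neq0 n)); rewrite divfK //.
by rewrite -(bin_fact le_in) natrM natrM mulrCA mulVf ?mulr1 // mulf_neq0.
Qed.

(* The action f |-> \sum_alpha V^alpha df/dt^alpha of the vector field with
   Taylor coefficients V, i.e. the derivatives at 0 of t |-> df(t)[V(t)]. *)
Definition rawact (W : lmodType K) (V : seq h -> h) (f : seq h -> W) : seq h -> W :=
  leibniz (fun v (k : h -> W) => k v) V (fun s v => f (v :: s)).

Lemma act_subproof (W : lmodType K) (V : formal_map h) (f : formal_map W) :
  rawact V f \in @symmetric_multilinear_pred W.
Proof.
apply/asboolP; split=> [|s a u v].
  apply: sym_leibniz; first exact: formal_map_sym.
  move=> s s' ss'; apply/funext => v; apply: (formal_map_sym f).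
  by rewrite perm_cons.
rewrite /rawact !leibniz_cons.
rewrite (@eq_leibniz _ _ _ _ (pder _ V) (fun r => a *: pder u V r + pder v V r)
  _ (fun s v => f (v :: s))) //; last by move=> r; apply: formal_map_linear.
rewrite leibniz_linearl; last by move=> r; apply: formal_map_linear.
pose df w r (x : h) := f [:: x, w & r].
rewrite (@eq_leibniz _ _ _ _ V V (pder (a *: u + v) _)
   (fun r => a *: df u r + df v r)) //; last first.
  move=> r; apply/funext => x; rewrite !fctE /pder /df.
  have swap y : f [:: x, y & r] = f [:: y, x & r].
    by apply: formal_map_sym; rewrite (perm_catCA [:: x] [:: y]).
  rewrite !swap; exact: formal_map_linear.
rewrite leibniz_linearr //.
by rewrite !scalerDr -!addrA; congr (_ + _); rewrite addrCA.
Qed.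

Definition act (W : lmodType K) (V : formal_map h) (f : formal_map W) :
  formal_map W := FormalMap (act_subproof V f).


Lemma rawact_nil (W : lmodType K) V (f : seq h -> W) :
  rawact V f [::] = f [:: V [::]].
Proof. by rewrite /rawact leibniz_nil. Qed.

Lemma pder_rawact (W : lmodType K) V (f : seq h -> W) v : sym f ->
  pder v (rawact V f) = rawact (pder v V) f \+ rawact V (pder v f).
Proof.
move=> fS; apply/funext => s; rewrite /pder /rawact leibniz_cons /=; congr (_ + _).
apply: eq_leibniz => // r; apply/funext => w; apply: fS.
by rewrite (perm_catCA [:: w] [:: v]).
Qed.

Lemma rawactD (W : lmodType K) V (f g : seq h -> W) :
  rawact V (f \+ g) = rawact V f \+ rawact V g.
Proof.
by apply/funext => s /=; rewrite /rawact /leibniz -big_split; apply: eq_bigr.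
Qed.

Lemma act_linear (W : lmodType K) (V : formal_map h) : linear (@act W V).
Proof.
by move=> a f g; apply: formal_mapP => s; apply: leibniz_linearr.
Qed.

Lemma rawactM V f g : sym f -> sym g ->
  rawact V (rawmul f g) = rawmul (rawact V f) g \+ rawmul f (rawact V g).
Proof.
move=> fS gS; apply/funext => s; elim: s V f g fS gS => [|v s IH] V f g fS gS /=.
  by rewrite rawact_nil /rawmul !leibniz_nil !rawact_nil leibniz_cons !leibniz_nil.
rewrite -[LHS]/(pder v _ s) pder_rawact; last exact: sym_leibniz.
rewrite pder_rawmul rawactD /= !IH //; try exact: sym_pder.
rewrite -[rawmul _ g (v :: s)]/(pder v _ s) -[rawmul f _ (v :: s)]/(pder v _ s).
rewrite !pder_rawmul !pder_rawact // [RHS]/= rawmulDl rawmulDr.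
by rewrite [LHS]/= addrACA [X in X + _]addrA [X in _ + X]addrCA addrACA.
Qed.

Definition derivation (D : formal_function -> formal_function) : Prop :=
  linear D /\ forall f g, D (f * g) = D f * g + f * D g.

Lemma act_derivation (V : formal_map h) : derivation (@act K^o V).
Proof.
split=> [|f g]; first exact: act_linear.
by apply: formal_mapP => s; rewrite /= rawactM //; apply: formal_map_sym.
Qed.

(* The part of V (W f) which is of second order in f. *)
Definition second_order (Z : lmodType K) (V W : seq h -> h) (f : seq h -> Z) :=
  leibniz (fun v (k : h -> Z) => k v) V (fun s v => rawact W (pder v f) s).

Lemma second_orderC (Z : lmodType K) V W (f : seq h -> Z) : sym f ->
  second_order V W f =1 second_order W V f.
Proof.
have cons V0 W0 (f0 : seq h -> Z) v s : sym f0 ->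
    second_order V0 W0 f0 (v :: s) = second_order (pder v V0) W0 f0 s +
    second_order V0 (pder v W0) f0 s + second_order V0 W0 (pder v f0) s.
  move=> fS; rewrite /second_order leibniz_cons -addrA; congr (_ + _).
  rewrite /leibniz -big_split; apply: eq_bigr => p _ /=.
  rewrite /pder -[rawact W0 _ (v :: _)]/(pder v _ _) pder_rawact; last exact: sym_pder.
  by rewrite pderC.
move=> fS s; elim: s V W f fS => [|v s IH] V W f fS.
  rewrite /second_order !leibniz_nil !rawact_nil; apply: fS.
  by rewrite (perm_catCA [:: _] [:: _]).
rewrite !cons // (IH (pder v V)) // (IH V (pder v W)) // (IH V W (pder v f)).
  by congr (_ + _); rewrite addrC.
exact: sym_pder.
Qed.

Lemma rawact_rawact (Z : lmodType K) V W (f : seq h -> Z) : sym W -> sym f ->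
  (forall s, linear (fun v => f (v :: s))) ->
  rawact V (rawact W f) = rawact (rawact V W) f \+ second_order V W f.
Proof.
move=> WS fS fL; apply/funext => s /=.
have -> : rawact V (rawact W f) s =
    leibniz (fun v (k : h -> Z) => k v) V (fun r v => rawact (pder v W) f r) s
    + second_order V W f s.
  rewrite /second_order /leibniz -big_split; apply: eq_bigr => p _ /=.
  rewrite -[rawact W f (_ :: _)]/(pder _ _ _) pder_rawact //.
congr (_ + _); elim: s V W f WS fS fL => [|v s IH] V W f WS fS fL.
  by rewrite !leibniz_nil !rawact_nil.
rewrite -[RHS]/(pder v _ s) pder_rawact // pder_rawact // leibniz_cons.
set A := rawact (pder v V) W; set B := rawact V (pder v W).
have -> : rawact (A \+ B) f = rawact A f \+ rawact B f.
  apply/funext => r /=; rewrite /rawact /leibniz -big_split; apply: eq_bigr => p _.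
  by have /= := fL p.2 1 (A p.1) (B p.1); rewrite !scale1r.
rewrite {}/A {}/B.
have fvL : forall r, linear (fun w => pder v f (w :: r)).
  have swap w r : f [:: v, w & r] = f [:: w, v & r].
    by apply: fS; rewrite (perm_catCA [:: v] [:: w]).
  by move=> r a x y; rewrite /pder !swap fL.
rewrite /= -!IH //; try exact: sym_pder.
rewrite -!addrA; congr (_ + _).
rewrite /leibniz -big_split; apply: eq_bigr => p _ /=.
rewrite -[LHS]/(pder v (rawact (pder (V p.1) W) f) p.2) pder_rawact //.
by rewrite pderC.
Qed.

Definition bracket (V W : formal_map h) : formal_map h := act V W - act W V.

Lemma act_bracket (Z : lmodType K) (V W : formal_map h) (f : formal_map Z) :
  act (bracket V W) f = act V (act W f) - act W (act V f).
Proof.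
have [[VS WS] fS] := (formal_map_sym V, formal_map_sym W, formal_map_sym f).
have fL := formal_map_linear f.
apply: formal_mapP => s; rewrite [LHS]/= [RHS]/= !rawact_rawact //.
transitivity (rawact (rawact V W) f s + second_order V W f s -
              (rawact (rawact W V) f s + second_order W V f s)); last by [].
rewrite second_orderC // opprD addrACA subrr addr0.
set A := rawact V W; set B := rawact W V; rewrite /rawact /leibniz -sumrB; apply: eq_bigr => p _ /=.
have /= := fL p.2 (-1) (B p.1) (A p.1).
by rewrite !scaleN1r ![- _ + _]addrC.
Qed.

(* Derivations V of the ring of formal functions having Taylor components in
   \prod_n Hom(S^n h, h). When h has finite dimension the second condition holds
   for every derivation, see derivation_vector_field. *)
Definition vector_field_pred : pred (formal_function -> formal_function) :=
  fun D => `[< derivation D /\ exists V : formal_map h, D = act V >].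

Record vector_field := VectorField {
  vf_fun :> formal_function -> formal_function;
  vf_funP : vf_fun \in vector_field_pred
}.

Lemma actDl (Z : lmodType K) a (V W : formal_map h) (f : formal_map Z) :
  act (a *: V + W) f = a *: act V f + act W f.
Proof.
apply: formal_mapP => s; apply: leibniz_linearl => r.
exact: formal_map_linear.
Qed.

Lemma vector_field_submod : submod_closed vector_field_pred.
Proof.
have act_vf (V : formal_map h) : @act K^o V \in vector_field_pred.
  by apply/asboolP; split; [exact: act_derivation|exists V].
split=> [|a D E /asboolP[_ [V ->]] /asboolP[_ [W ->]]].
  have -> : 0 = @act K^o 0 :> (formal_function -> formal_function); last exact: act_vf.
  apply/funext => f; have := actDl (-1) 0 0 f.
  by rewrite scaler0 addr0 scaleN1r addNr.
have -> : a *: (act V : formal_function -> formal_function) + act W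
  = act (a *: V + W); last exact: act_vf.
by apply/funext => f; rewrite actDl.
Qed.

HB.instance Definition _ :=
  GRing.isSubmodClosed.Build K (formal_function -> formal_function)
    vector_field_pred vector_field_submod.
HB.instance Definition _ := [isSub for vf_fun].
HB.instance Definition _ := [Choice of vector_field by <:].
HB.instance Definition _ := [SubChoice_isSubLmodule of vector_field by <:].

Lemma vf_linear (D : vector_field) : linear D.
Proof. by have /asboolP[[]] := vf_funP D. Qed.

Lemma commutator_subproof (D E : vector_field) :
  (fun f => D (E f) - E (D f)) \in vector_field_pred.
Proof.
have /asboolP[_ [V DV]] := vf_funP D; have /asboolP[_ [W EW]] := vf_funP E.
have -> : (fun f => D (E f) - E (D f)) = act (bracket V W).
  by apply/funext => f; rewrite DV EW act_bracket.
by apply/asboolP; split; [exact: act_derivation|exists (bracket V W)].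
Qed.

Definition commutator (D E : vector_field) : vector_field :=
  VectorField (commutator_subproof D E).

Lemma vfB (D : vector_field) f g : D (f - g) = D f - D g.
Proof. by rewrite addrC -scaleN1r vf_linear scaleN1r addrC. Qed.

Lemma commutator_linearl E : linear (fun D => commutator D E).
Proof.
move=> a D D'; apply/val_inj/funext => f; rewrite /= !fctE /= vf_linear.
by rewrite scalerBr opprD addrACA.
Qed.

Lemma commutator_linearr D : linear (commutator D).
Proof.
move=> a E E'; apply/val_inj/funext => f; rewrite /= !fctE /= vf_linear.
by rewrite scalerBr opprD addrACA.
Qed.

Lemma commutatorxx D : commutator D D = 0.
Proof. by apply/val_inj/funext => f; rewrite /= subrr. Qed.

Lemma commutator_jacobi x y z :
  commutator x (commutator y z) + commutator y (commutator z x)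
  + commutator z (commutator x y) = 0.
Proof.
apply/val_inj/funext => f; rewrite /= !fctE /= !vfB.
set a := x (y (z f)); set b := x (z (y f)); set c := y (z (x f)).
set d := y (x (z f)); set e := z (x (y f)); set k := z (y (x f)).
rewrite !opprB (addrACA a) (addrACA c) (addrACA e) -!opprD.
by rewrite (addrC c b) (addrC e d) (addrC k a) !subrKA subrr.
Qed.

HB.instance Definition _ := Lmodule_isLieAlgebra.Build K vector_field
  commutator_linearl commutator_linearr commutatorxx commutator_jacobi.

Lemma linear_function_subproof (l : h -> K^o) : linear l ->
  (fun s => if s is [:: v] then l v else 0) \in @symmetric_multilinear_pred K^o.
Proof.
move=> lL; apply/asboolP; split=> [s s' ss'|[|w s] a u v]; last 2 first.
- exact: lL.
- by rewrite scaler0 addr0.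
have := perm_size ss'; case: s ss' => [|v [|v' s]] ss'; case: s' ss' => [|w [|w' s']] //.
by move=> /perm_mem /(_ v); rewrite !inE eqxx => /esym /eqP ->.
Qed.

Definition linear_function (l : h -> K^o) (lL : linear l) : formal_function :=
  FormalMap (linear_function_subproof lL).

Definition coordinate (I : choiceType) (e : basis h I) (i : I) : formal_function :=
  linear_function (@dual_linear _ _ _ e i).

Lemma splits_perm s p : p \in splits s -> perm_eq (p.1 ++ p.2) s.
Proof.
elim: s p => [|v s IH] p /=; first by rewrite inE => /eqP ->.
rewrite mem_cat => /orP[] /mapP[q qs ->] /=; first by rewrite perm_cons IH.
by rewrite -cat_rcons -cats1 perm_catAC -[v :: s]cat1s perm_catC perm_cat2l IH.
Qed.

Lemma count_splits0 s : count (fun p => size p.1 == 0)%N (splits s) = 1%N.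
Proof.
by elim: s => //= v s IH; rewrite count_cat !count_map count_pred0 IH.
Qed.

Lemma count_splits1 s : count (fun p => size p.1 == 1)%N (splits s) = size s.
Proof.
elim: s => //= v s IH; rewrite count_cat !count_map /= -[RHS]add1n -IH.
by congr (_ + _)%N; rewrite -[RHS](count_splits0 s); apply: eq_count.
Qed.

Lemma rawact_linear_function (l : h -> K^o) (lL : linear l) V s :
  rawact V (linear_function lL) s = l (V s).
Proof.
elim: s V => [|v s IH] V; first by rewrite rawact_nil.
rewrite -[LHS]/(pder v _ s) pder_rawact; last exact: formal_map_sym.
rewrite /= IH /pder /rawact /leibniz big1 ?addr0 // => p _.
Qed.

(* The Taylor components are no restriction in finite dimension: by Euler's
   formula f = f(0) + \sum_alpha t^alpha g_alpha, so a derivation is determined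
   by its values on the coordinates t^alpha. *)
Lemma derivation_vector_field (I : finType) (e : basis h I) D :
  [pchar K] =i pred0 -> derivation D -> D \in vector_field_pred.
Proof.
move=> /pcharf0P charK DD; have [DL DM] := DD.
pose V s : h := \sum_i D (coordinate e i) s *: e i.
have VP : V \in @symmetric_multilinear_pred h.
  apply/asboolP; split=> [s s' ss'|s a u v]; rewrite /V.
    by apply: eq_bigr => i _; rewrite (formal_map_sym _ ss').
  rewrite scaler_sumr -big_split; apply: eq_bigr => i _.
  by rewrite formal_map_linear scalerDl scalerA.
pose W := FormalMap VP.
have span v : v = \sum_i dual e i v *: e i.
  rewrite [LHS](dual_span e) (fsbigE (enum I)) ?enum_uniq //; last first.
    by move=> i _; rewrite mem_enum.
  by rewrite big_enum_cond; apply: eq_bigl => i; rewrite in_setT.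
pose E f := D f - act W f.
have EL : linear E.
  by move=> a f g; rewrite /E DL act_linear scalerBr opprD addrACA.
have EM f g : E (f * g) = E f * g + f * E g.
  have [_ aM] := act_derivation W.
  by rewrite /E DM aM mulrBl mulrBr opprD addrACA.
have E0 : E 0 = 0 by have := EL (-1) 0 0; rewrite scaler0 addr0 scaleN1r addNr.
have ED f g : E (f + g) = E f + E g by have := EL 1 f g; rewrite !scale1r.
have E1 : E 1 = 0.
  by have := EM 1 1; rewrite !mulr1 mul1r => /eqP; rewrite -subr_eq0 opprD addrA subrr sub0r oppr_eq0 => /eqP.
have Ecoord i : E (coordinate e i) = 0.
  apply: formal_mapP => s.
  rewrite -[LHS]/(D (coordinate e i) s - rawact V (coordinate e i) s).
  rewrite rawact_linear_function /V.
  have dualL := @dual_linear _ _ _ e i.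
  have dual0 : dual e i 0 = 0.
    by have := dualL (-1) 0 0; rewrite scaler0 addr0 scaleN1r addNr.
  have -> : dual e i (\sum_j D (coordinate e j) s *: e j) =
      \sum_j D (coordinate e j) s * dual e i (e j).
    elim/big_rec2: _ => // j x y _ <-; exact: dualL.
  rewrite (bigD1 i) //= dual_bvec eqxx mulr1 big1 ?addr0 ?subrr // => j ji.
  by rewrite dual_bvec eq_sym (negPf ji) mulr0.
suff Ef n f s : (size s < n)%N -> E f s = 0.
  apply/asboolP; split=> //; exists W; apply/funext => f.
  apply/eqP; rewrite -subr_eq0; apply/eqP/formal_mapP => s; exact: (Ef (size s).+1).
elim: n f s => // n IH f s; rewrite ltnS => le_sn.
have gP i : (fun r => (size r).+1%:R^-1 * f (e i :: r) : K^o)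
    \in @symmetric_multilinear_pred K^o.
  apply/asboolP; split=> [r r' rr'|r a u v].
    by rewrite (perm_size rr') (formal_map_sym f (_ : perm_eq _ (e i :: r'))) ?perm_cons.
  have swap w : f [:: e i, w & r] = f [:: w, e i & r].
    by apply: formal_map_sym; rewrite (perm_catCA [:: e i] [:: w]).
  by rewrite !swap formal_map_linear mulrDr /= -[a *: _]/(a * _) mulrCA.
pose g i : formal_function := FormalMap (gP i).
have euler : f = (f [::] : K) *: (1 : formal_function)
                   + (\sum_i coordinate e i * g i : formal_function).
  apply: formal_mapP => r.
  have sumE (F : I -> formal_function) : (\sum_i F i) r = \sum_i F i r.
    by elim/big_rec2: _ => // j x y _ <-.
  rewrite -[RHS]/(f [::] * (r == [::])%:R + (\sum_i coordinate e i * g i) r) sumE.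
  have -> : \sum_i (coordinate e i * g i) r =
      \sum_(p <- splits r) if size p.1 == 1%N then (size r)%:R^-1 * f r else 0.
    rewrite /= /rawmul /leibniz exchange_big /= !big_seq; apply: eq_bigr => p.
    move=> /splits_perm; case: p => [[|v [|v' q]] q'] /= pr; try by rewrite big1 // => i _; rewrite mul0r.
    rewrite -(perm_size pr) -(formal_map_sym f pr) /=.
    under eq_bigr do rewrite mulrCA.
    rewrite -mulr_sumr; congr (_ * _); rewrite {2}(span v).
    have fL := formal_map_linear f q'.
    have f0 : f (0 :: q') = 0.
      by have := fL (-1) 0 0; rewrite scaler0 addr0 scaleN1r addNr.
    by elim/big_rec2: _ => // j x y _ ->; rewrite fL.
  rewrite -big_mkcond big_const_seq count_splits1 iter_addr_0.
  case: r {sumE} => [|v r]; first by rewrite eqxx mulr1 mulr0n addr0.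
  by rewrite mulr0 add0r -mulrnAl -mulr_natr mulVf ?mul1r // charK.
have -> : E f = \sum_i coordinate e i * E (g i).
  rewrite {1}euler EL E1 scaler0 add0r (big_morph E ED E0); apply: eq_bigr => i _.
  by rewrite EM Ecoord mul0r add0r.
have sumE (F : I -> formal_function) : (\sum_i F i) s = \sum_i F i s.
  by elim/big_rec2: _ => // j x y _ <-.
rewrite sumE big1 // => i _; rewrite /= /rawmul /leibniz big1_seq // => p /= /splits_perm.
case: p => [[|v [|v' q]] q'] /= pr; try by rewrite mul0r.
have Eq : E (g i) q' = 0 by apply: IH; rewrite (leq_trans _ le_sn) // -(perm_size pr).
exact: etrans (congr1 ( *%R (dual e i v)) Eq) (mulr0 _).
Qed.

(* f = \sum_j u j, where each Taylor coefficient of the sum has only finitely many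
   nonzero terms. *)
Definition is_formal_sum (J : choiceType) (u : J -> formal_function)
    (f : formal_function) : Prop :=
  forall s, finite_set [set j | u j s != 0]%classic /\
            f s = \sum_(j \in [set: J]) u j s.

End FormalMaps.

Definition structure_constant (K : fieldType) (h : lieAlgType K) (I : choiceType)
    (e : basis h I) (alpha beta gamma : I) : K :=
  dual e gamma (lie (e alpha) (e beta)).

(* A structure of formal g-homogeneous space on the vector space h. *)
Definition formal_homogeneous_structure (K : fieldType) (g : lieAlgType K)
    (h : lmodType K) : Type := lie_hom g (vector_field h).

(* B_n / n! phi_a^{gamma_1} C_{gamma_1 beta_1}^{gamma_2} ...
   C_{gamma_n beta_n}^{gamma_{n+1}} t^{beta_1} ... t^{beta_n}, where
   gamma_{n+1} = alpha is the default value of nth; the indices of the tuples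
   start at 0. *)
Definition bernoulli_term (K : fieldType) (g h : lieAlgType K) (phi : lie_hom g h)
    (A I : choiceType) (ea : basis g A) (e : basis h I) (a : A) (alpha : I)
    (n : nat) (gamma beta : n.-tuple I) : formal_function h :=
  (ratr (bernoulli n) / n`!%:R
   * dual e (nth alpha gamma 0) (phi (ea a))
   * \prod_(k < n) structure_constant e
       (nth alpha gamma k) (tnth beta k) (nth alpha gamma k.+1) : K)
  *: (\prod_(k < n) coordinate e (tnth beta k) : formal_function h).

(* Main.v *)
From HB Require Import structures.
Require Import Defs.
From mathcomp Require Import all_boot all_order all_algebra.
From mathcomp Require Import boolp classical_sets functions cardinality fsbigop.
From mathcomp Require Import ring.

(** The formula for F_phi (x) is the Taylor expansion of a left-invariant vector
    field in exponential coordinates, and left-invariant vector fields bracket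
    like the Lie algebra.  The proof below is this argument made formal, so that
    it needs neither a group nor convergence.

    Let T be the identity of h, viewed as a formal map from h to h, and let
    R f = [f, T] ([lier]) for the pointwise bracket of h-valued formal maps.  Since R
    raises the order of vanishing at 0, a power series c(R) = sum_n c_n R^n acts
    on formal maps ([adseries]), and c(R) d(R) = (c d)(R).  The field attached to
    x in h is V_x = b(R) x, where x is a constant map and b(z) = z / (e^z - 1) has
    the coefficients B_n / n!; contracting with a basis gives the stated formula,
    because (R^n x)(t) = [..[[x, t], t].., t].

    Put E(z) = (e^z - 1) / z, the inverse of b, so that E(R) V_x = x.  Since
    R = -ad T, E(R) = (1 - e^(-ad T)) / ad T is the left Maurer-Cartan form pulled
    back by the exponential map, and the fields X with E(R) X constant are the
    left-invariant ones.  The heart of the proof ([bracket_invariant]) is the structure equation: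
    if E(R) X = x and E(R) Y = y are constant, then E(R) [X, Y] = [x, y].  The
    derivative D along X kills y and sends T to X, and a derivation D satisfies
      D R^n f = R^n D f + sum_(p < n) C(n, p) [R^p f, R^(n - 1 - p) (D T)]
    ([derivation_iter_lier]).  Expanding D E(R) Y = 0, antisymmetrizing in X and Y
    and using
      (C(m + 1, p) + C(m + 1, p + 1)) / (m + 2)! = 1 / ((p + 1)! (m - p + 1)!)
    turns the correction terms into [E(R) X, E(R) Y] = [x, y].  Applying b(R)
    yields [V_x, V_y] = V_[x, y], and phi is a morphism.

    For the coordinate formula, h may be of infinite dimension: at a given list of
    arguments one has to see that only finitely many terms contribute.  This is
    carried by [expansion], linear combinations with explicit finite support,
    which are stable under substitution of one combination into another. *)

Set Implicit Arguments.
Unset Strict Implicit.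
Unset Printing Implicit Defensive.
Import GRing.Theory.
Local Open Scope ring_scope.

(** * Derivations and iterated brackets in a Lie algebra *)

Section LieAlgebraTheory.
Variables (K : fieldType) (L : lieAlgType K).
Implicit Types (f t u v : L).

(** Bracketing with t on the right, that is -ad t, is the sign convention for which
    the Bernoulli numbers appear without extra signs (-1)^n. *)
Definition lier t f := lie f t.

HB.instance Definition _ u :=
  GRing.isLinear.Build K L L *:%R (lie u) (lie_linearr u).
HB.instance Definition _ t :=
  GRing.isLinear.Build K L L *:%R (lier t) (lie_linearl t).

Lemma lieC u v : lie u v = - lie v u.
Proof.
apply/eqP; rewrite -addr_eq0; apply/eqP; have := liexx (u + v).
rewrite linearD /= -![lie (u + v) _]/(lier _ _) !linearD /= /lier.
by rewrite !liexx add0r addr0 addrC.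
Qed.

Lemma lieZl a u v : lie (a *: u) v = a *: lie u v.
Proof. exact: (linearZ_LR (lier v)). Qed.

Lemma lieZr a u v : lie u (a *: v) = a *: lie u v.
Proof. exact: linearZ_LR. Qed.

Lemma lie_suml (J : Type) (r : seq J) (F : J -> L) v :
  lie (\sum_(i <- r) F i) v = \sum_(i <- r) lie (F i) v.
Proof. exact: (linear_sum (lier v)). Qed.

Lemma lie_sumr (J : Type) (r : seq J) u (F : J -> L) :
  lie u (\sum_(i <- r) F i) = \sum_(i <- r) lie u (F i).
Proof. exact: linear_sum. Qed.

Lemma lier_derivation t u v : lier t (lie u v) = lie (lier t u) v + lie u (lier t v).
Proof.
rewrite /lier [lie (lie u v) t]lieC [lie (lie u t) v]lieC [lie u t]lieC.
rewrite linearN opprK; apply/eqP.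
by rewrite eq_sym -addr_eq0 [X in X + _]addrC lie_jacobi.
Qed.

Lemma iter_lier_linear t n : linear (iter n (lier t)).
Proof. by elim: n => // n IH a u v; rewrite !iterS IH linearP. Qed.

HB.instance Definition _ t n :=
  GRing.isLinear.Build K L L *:%R (iter n (lier t)) (iter_lier_linear t n).

(** Moving D through the n brackets with t leaves R^i [R^j f, D t] for each
    i + j = n - 1; as R is itself a derivation, expanding R^i by the binomial
    formula and summing over i collects the coefficients 'C(n, p).  Pascal's rule
    does both at once by induction on n. *)
Lemma derivation_iter_lier (D : {linear L -> L}) t n f :
  (forall u v, D (lie u v) = lie (D u) v + lie u (D v)) ->
  D (iter n (lier t) f) = iter n (lier t) (D f) +
    \sum_(p < n) 'C(n, p)%:R *:
       lie (iter p (lier t) f) (iter (n - p).-1 (lier t) (D t)).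
Proof.
move=> DL; elim: n f => [|n IH] f; first by rewrite big_ord0 addr0.
rewrite iterS {1}/lier DL -[X in X + _]/(lier t _) IH linearD linear_sum /= -addrA.
congr (_ + _).
pose G p := lie (iter p (lier t) f) (iter (n - p) (lier t) (D t)).
transitivity (\sum_(p < n) 'C(n, p)%:R *: (G p.+1 + G p) + G n).
  rewrite [G n]/G subnn; congr (_ + _); apply: eq_bigr => p _.
  rewrite linearZ /= lier_derivation /G subnS; congr (_ *: (_ + lie _ _)).
  by rewrite -iterS prednK // subn_gt0.
transitivity (\sum_(p < n.+1) 'C(n.+1, p)%:R *: G p); last first.
  by apply: eq_bigr => p _; rewrite /G subSn // -ltnS.
under eq_bigr do rewrite scalerDr.
rewrite big_split /= -addrA.
have <- : \sum_(p < n.+1) 'C(n, p)%:R *: G p = \sum_(p < n) 'C(n, p)%:R *: G p + G n.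
  by rewrite big_ord_recr /= binn scale1r.
rewrite !big_ord_recl /=.
rewrite !bin0 addrCA -big_split; congr (_ + _); apply: eq_bigr => p _.
by rewrite /bump !add1n binS natrD scalerDl addrC.
Qed.
End LieAlgebraTheory.

(** * The Leibniz rule for an arbitrary bilinear operation *)

Section Leibniz.
Variables (K : fieldType) (V U W Z : lmodType K) (b : U -> W -> Z).
Hypotheses (bl : forall w, linear (b^~ w)) (br : forall u, linear (b u)).

Lemma leibnizDl (f1 f2 : seq V -> U) g s :
  leibniz b (f1 \+ f2) g s = leibniz b f1 g s + leibniz b f2 g s.
Proof.
rewrite /leibniz -big_split; apply: eq_bigr => p _ /=.
by have := bl (g p.2) 1 (f1 p.1) (f2 p.1); rewrite !scale1r.
Qed.

Lemma leibnizDr f (g1 g2 : seq V -> W) s :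
  leibniz b f (g1 \+ g2) s = leibniz b f g1 s + leibniz b f g2 s.
Proof.
rewrite /leibniz -big_split; apply: eq_bigr => p _ /=.
by have := br (f p.1) 1 (g1 p.2) (g2 p.2); rewrite !scale1r.
Qed.

Lemma pder_leibniz v (f : seq V -> U) (g : seq V -> W) :
  pder v (leibniz b f g) = leibniz b (pder v f) g \+ leibniz b f (pder v g).
Proof. by apply/funext => s; rewrite /pder leibniz_cons. Qed.

Lemma leibniz_subproof (f : formal_map V U) (g : formal_map V W) :
  leibniz b f g \in @symmetric_multilinear_pred K V Z.
Proof.
apply/asboolP; split=> [|s a u v].
  by apply: sym_leibniz; apply: formal_map_sym.
rewrite !leibniz_cons.
have pderP (X : lmodType K) (k : formal_map V X) :
    pder (a *: u + v) k = (fun r => a *: pder u k r + pder v k r).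
  by apply/funext => r; apply: formal_map_linear.
rewrite !pderP leibniz_linearl // leibniz_linearr //.
by rewrite scalerDr !addrA; congr (_ + _); rewrite addrAC.
Qed.

Lemma rawact_leibniz X (f : seq V -> U) (g : seq V -> W) : sym f -> sym g ->
  rawact X (leibniz b f g) =
  leibniz b (rawact X f) g \+ leibniz b f (rawact X g).
Proof.
move=> fS gS; apply/funext => s.
elim: s X f g fS gS => [|v s IH] X f g fS gS /=.
  by rewrite rawact_nil !leibniz_nil !rawact_nil leibniz_cons !leibniz_nil.
rewrite -[LHS]/(pder v _ s) pder_rawact; last exact: sym_leibniz.
rewrite pder_leibniz rawactD /= !IH //; try exact: sym_pder.
rewrite !leibniz_cons !pder_rawact // leibnizDl leibnizDr.
by rewrite [LHS]/= addrACA [X in X + _]addrA [X in _ + X]addrCA addrACA.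
Qed.

(** Orders of vanishing at 0 add up under a bilinear operation: each split of a
    list shorter than m + n has a left part shorter than m or a right part shorter
    than n. *)
Lemma leibniz_vanish m n (f : seq V -> U) (g : seq V -> W) :
  (forall s, (size s < m)%N -> f s = 0) -> (forall s, (size s < n)%N -> g s = 0) ->
  forall s, (size s < m + n)%N -> leibniz b f g s = 0.
Proof.
have b0l w : b 0 w = 0.
  by have := bl w (-1) 0 0; rewrite scaler0 addr0 scaleN1r addNr.
have b0r u : b u 0 = 0.
  by have := br u (-1) 0 0; rewrite scaler0 addr0 scaleN1r addNr.
move=> f0 g0 s lt_s; rewrite /leibniz big1_seq // => p /andP[_ /splits_perm ps].
have [/f0-> //|le_mp] := ltnP (size p.1) m.
rewrite (g0 p.2) // -(ltn_add2l (size p.1)) -size_cat (perm_size ps).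
by rewrite (leq_trans lt_s) // leq_add2r.
Qed.

(** A product only involves the parts of its factors of degree at most its own;
    this is what lets an infinite series be truncated inside a bracket. *)
Lemma leibniz_agree n (f1 f2 : seq V -> U) (g1 g2 : seq V -> W) :
  (forall s, (size s < n)%N -> f1 s = f2 s) ->
  (forall s, (size s < n)%N -> g1 s = g2 s) ->
  forall s, (size s < n)%N -> leibniz b f1 g1 s = leibniz b f2 g2 s.
Proof.
move=> f12 g12 s lt_s; apply: eq_big_seq => p /splits_perm /perm_size ps.
by rewrite f12 ?g12 // (leq_ltn_trans _ lt_s) // -ps size_cat ?leq_addl ?leq_addr.
Qed.
End Leibniz.

(** * The Lie algebra of formal maps with values in a Lie algebra *)

Section FormalLie.
Variables (K : fieldType) (V : lmodType K) (L : lieAlgType K).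

Definition formal_lie (f g : formal_map V L) : formal_map V L :=
  FormalMap (leibniz_subproof (@lie_linearl K L) (@lie_linearr K L) f g).

Lemma formal_lie_linearl g : linear (formal_lie^~ g).
Proof.
move=> a f1 f2; apply: formal_mapP => s; apply: leibniz_linearl => r.
exact: lie_linearl.
Qed.

Lemma formal_lie_linearr f : linear (formal_lie f).
Proof.
move=> a g1 g2; apply: formal_mapP => s; apply: leibniz_linearr.
exact: lie_linearr.
Qed.

Lemma leibniz_lieC (f g : seq V -> L) s : leibniz lie f g s = - leibniz lie g f s.
Proof.
elim: s f g => [|v s IH] f g; first by rewrite !leibniz_nil lieC.
by rewrite !leibniz_cons IH (IH f) opprD addrC.
Qed.

Lemma formal_liexx f : formal_lie f f = 0.
Proof.
apply: formal_mapP => -[|v s] /=; first by rewrite leibniz_nil liexx.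
by rewrite leibniz_cons leibniz_lieC addNr.
Qed.

Lemma formal_lie_jacobi f g k :
  formal_lie f (formal_lie g k) + formal_lie g (formal_lie k f)
  + formal_lie k (formal_lie f g) = 0.
Proof.
apply: formal_mapP => s /=.
elim: s (taylor f) (taylor g) (taylor k) => [|v s IH] {}f {}g {}k.
  by rewrite !fctE !leibniz_nil lie_jacobi.
have lieDr := leibnizDr (@lie_linearr K L).
rewrite !fctE !leibniz_cons !pder_leibniz !lieDr.
rewrite (AC ((1*2)*(1*2)*(1*2)) ((1*6*8)*(2*4*9)*(3*5*7)))%AC /=.
transitivity (0 + 0 + 0 : L); last by rewrite !addr0.
by congr (_ + _ + _); apply: IH.
Qed.

HB.instance Definition _ := Lmodule_isLieAlgebra.Build K (formal_map V L)
  formal_lie_linearl formal_lie_linearr formal_liexx formal_lie_jacobi.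
End FormalLie.

(** * Power series in a bracketing operator *)

Lemma triangular_sum (W : nmodType) N (F : nat -> nat -> W) :
  (forall p q, (N <= p + q)%N -> F p q = 0) ->
  \sum_(p < N) \sum_(q < N) F p q = \sum_(m < N) \sum_(p < m.+1) F p (m - p)%N.
Proof.
move=> F0; have -> : \sum_(m < N) \sum_(p < m.+1) F p (m - p)%N =
    \sum_(0 <= m < N) \sum_(0 <= p < N | (p < m.+1)%N) F p (m - p)%N.
  rewrite big_mkord; apply: eq_bigr => m _.
  by rewrite -[LHS](big_mkord xpredT (fun p => F p (m - p)%N)) (big_nat_widen _ _ N).
rewrite (exchange_big_dep_nat xpredT) //= big_mkord; apply: eq_bigr => p _.
transitivity (\sum_(p <= m < N) F p (m - p)%N); last first.
  rewrite (big_nat_widenl _ 0) //; apply: eq_bigl => m; by rewrite ltnS.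
rewrite -[X in \sum_(X <= _ < _) _](add0n (p : nat)) big_addn big_mkord.
under [RHS]eq_bigr do rewrite addnK.
rewrite [RHS](big_ord_widen N (F p)) ?leq_subr // [RHS]big_mkcond.
apply: eq_bigr => q _; case: ltnP => // le_q; apply: F0.
by rewrite -leq_subLR.
Qed.

Lemma taylor_sum (K : fieldType) (V W : lmodType K) (J : Type) (r : seq J)
    (P : pred J) (F : J -> formal_map V W) s :
  (\sum_(i <- r | P i) F i) s = \sum_(i <- r | P i) F i s.
Proof. by elim/big_rec2: _ => // i x y _ <-. Qed.

Section AdSeries.
Variables (K : fieldType) (V : lmodType K) (L : lieAlgType K).
Variable t : formal_map V L.
Implicit Types (c d : nat -> K) (f g : formal_map V L) (s : seq V).

(** The series sum_n c_n R^n f.  When t vanishes at 0, R^n f has order at least n,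
    so the terms beyond the length of s contribute nothing to the coefficient at s
    and the sum is cut there. *)
Definition adseries_fun c f s : L :=
  \sum_(n < (size s).+1) c n *: iter n (lier t) f s.

Lemma adseries_subproof c f :
  adseries_fun c f \in @symmetric_multilinear_pred K V L.
Proof.
apply/asboolP; split=> [s s' ss'|s a u v]; rewrite /adseries_fun.
  by rewrite (perm_size ss'); apply: eq_bigr => n _; rewrite (formal_map_sym _ ss').
rewrite scaler_sumr -big_split; apply: eq_bigr => n _ /=.
by rewrite formal_map_linear scalerDr !scalerA mulrC.
Qed.

Definition adseries c f := FormalMap (adseries_subproof c f).

Lemma adseries_linear c : linear (adseries c).
Proof.
move=> a f g; apply: formal_mapP => s.
rewrite -[RHS]/(a *: adseries_fun c f s + adseries_fun c g s) /= /adseries_fun.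
rewrite scaler_sumr -big_split; apply: eq_bigr => n _ /=.
by rewrite linearP [LHS]scalerDr !scalerA mulrC.
Qed.

HB.instance Definition _ c :=
  GRing.isLinear.Build K (formal_map V L) (formal_map V L) *:%R (adseries c)
    (adseries_linear c).

Hypothesis t0 : t [::] = 0.

Lemma iter_lier_vanish n f s : (size s < n)%N -> iter n (lier t) f s = 0.
Proof.
elim: n s => // n IH s; rewrite iterS -[n.+1]addn1.
apply: (leibniz_vanish (@lie_linearl K L) (@lie_linearr K L)) => // -[] //.
Qed.

Lemma iter_lier_agree N n f g :
  (forall s, (size s < N)%N -> f s = g s) ->
  forall s, (size s < N)%N -> iter n (lier t) f s = iter n (lier t) g s.
Proof.
move=> fg; elim: n => //= n IH s; exact: leibniz_agree.
Qed.

(** One common truncation for all short lists turns identities between series into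
    identities between finite sums of formal maps, to which linearity applies. *)
Lemma adseries_trunc N c f s : (size s < N)%N ->
  adseries c f s = \sum_(n < N) c n *: iter n (lier t) f s.
Proof.
move=> lt_sN; rewrite /= /adseries_fun.
rewrite (big_ord_widen N (fun n => c n *: iter n (lier t) f s)) // big_mkcond.
apply: eq_bigr => n _; case: ltnP => // lt_sn.
by rewrite iter_lier_vanish ?scaler0.
Qed.

Definition cauchy_prod c d n := \sum_(k < n.+1) c k * d (n - k)%N.

Lemma adseries_comp c d f :
  adseries c (adseries d f) = adseries (cauchy_prod c d) f.
Proof.
apply: formal_mapP => s; pose N := (size s).+1.
rewrite !(@adseries_trunc N) //.
transitivity (\sum_(n < N) \sum_(k < N)
    c n *: (d k *: iter (n + k) (lier t) f s)).
  apply: eq_bigr => n _.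
  rewrite (iter_lier_agree n
    (g := \sum_(k < N) d k *: iter k (lier t) f) _ (ltnSn _)).
    rewrite linear_sum taylor_sum scaler_sumr; apply: eq_bigr => k _.
    by rewrite linearZ /= iterD.
  by move=> r lt_r; rewrite (adseries_trunc _ _ lt_r) taylor_sum.
rewrite (@triangular_sum _ N
  (fun n k => c n *: (d k *: iter (n + k) (lier t) f s))); last first.
  by move=> p q le_N; rewrite iter_lier_vanish // !scaler0.
apply: eq_bigr => m _; rewrite scaler_suml; apply: eq_bigr => k _.
by rewrite scalerA subnKC // -ltnS.
Qed.

Lemma lie_adseries N c d f g s : (size s < N)%N ->
  lie (adseries c f) (adseries d g) s =
  \sum_(m < N) \sum_(p < m.+1) (c p * d (m - p)%N) *:
    lie (iter p (lier t) f) (iter (m - p) (lier t) g) s.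
Proof.
move=> lt_s.
have -> : lie (adseries c f) (adseries d g) s =
    lie (\sum_(p < N) c p *: iter p (lier t) f)
        (\sum_(q < N) d q *: iter q (lier t) g) s.
  apply: leibniz_agree lt_s => r lt_r;
    by rewrite (adseries_trunc _ _ lt_r) taylor_sum.
transitivity (\sum_(p < N) \sum_(q < N) (c p * d q) *:
    lie (iter p (lier t) f) (iter q (lier t) g) s).
  rewrite lie_suml taylor_sum; apply: eq_bigr => p _.
  rewrite lie_sumr taylor_sum; apply: eq_bigr => q _.
  by rewrite lieZl lieZr scalerA.
rewrite (@triangular_sum _ N (fun p q => (c p * d q) *:
    lie (iter p (lier t) f) (iter q (lier t) g) s)) // => p q le_N.
rewrite [X in _ *: X](_ : _ = 0) ?scaler0 //.
apply: (leibniz_vanish (@lie_linearl K L) (@lie_linearr K L) (m := p) (n := q)).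
- by move=> r; apply: iter_lier_vanish.
- by move=> r; apply: iter_lier_vanish.
- exact: leq_trans lt_s le_N.
Qed.

End AdSeries.

(** * Left-invariant formal vector fields *)

Section InvariantFields.
Variables (K : fieldType) (h : lieAlgType K).
Implicit Types (X Y : formal_map h h).

Lemma identity_map_subproof :
  (fun s => if s is [:: v] then v else 0) \in @symmetric_multilinear_pred K h h.
Proof.
apply/asboolP; split=> [s s' ss'|[|w s] a u v]; rewrite ?scaler0 ?addr0 //.
have := perm_size ss'; case: s ss' => [|v [|? ?]]; case: s' => [|w [|? ?]] //.
by move=> /perm_mem /(_ v); rewrite !inE eqxx => /esym /eqP ->.
Qed.

Definition identity_map := FormalMap identity_map_subproof.

Lemma const_map_subproof (x : h) :
  (fun s => if s is [::] then x else 0) \in @symmetric_multilinear_pred K h h.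
Proof.
apply/asboolP; split=> [s s' ss'|s a u v]; last by rewrite scaler0 addr0.
by have := perm_size ss'; case: s {ss'}; case: s'.
Qed.

Definition const_map x := FormalMap (const_map_subproof x).

Lemma const_map_linear : linear const_map.
Proof.
move=> a x y; apply: formal_mapP => -[|v s] //=.
by rewrite !fctE /= scaler0 addr0.
Qed.

Lemma lie_const_map x y : lie (const_map x) (const_map y) = const_map (lie x y).
Proof.
apply: formal_mapP => s.
case: s => [|v s]; first by rewrite /= leibniz_nil.
rewrite /= /leibniz big1_seq // => p /andP[_ /splits_perm].
case: p => [[|u q] [|u' q']] /= ps; last 3 first.
- exact: (linear0 (lie x)).
- exact: (linear0 (lier y)).
- exact: (linear0 (lier 0)).
by have := perm_size ps.
Qed.

HB.instance Definition _ (W : lmodType K) X :=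
  GRing.isLinear.Build K (formal_map h W) (formal_map h W) *:%R
    (@act K h W X) (@act_linear K h W X).

Lemma act_lie X f g :
  act X (lie f g) = lie (act X f) g + lie f (act X g) :> formal_map h h.
Proof.
apply: formal_mapP => s.
have := rawact_leibniz (@lie_linearl K h) (@lie_linearr K h) X
  (formal_map_sym f) (formal_map_sym g).
by move/(congr1 (fun k => k s)).
Qed.

(** The identity is the coordinate function with values in h, so a vector field is
    recovered from its action on it. *)
Lemma act_identity X : act X identity_map = X.
Proof.
apply: formal_mapP => s; rewrite /=.
elim: s (taylor X) => [|v s IH] {}X; first by rewrite rawact_nil.
rewrite -[LHS]/(pder v _ s) pder_rawact; last exact: (formal_map_sym identity_map).
rewrite /= IH /rawact /leibniz big1 ?addr0 // => -[? []] //.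
Qed.

Lemma act_const X x : act X (const_map x) = 0.
Proof. by apply: formal_mapP => s; rewrite /= /rawact /leibniz big1. Qed.

Lemma act_agree N X (f g : formal_map h h) :
  (forall s, (size s < N.+1)%N -> f s = g s) ->
  forall s, (size s < N)%N -> act X f s = act X g s.
Proof.
move=> fg s lt_s; apply: eq_big_seq => p /splits_perm /perm_size ps.
by rewrite fg //= ltnS (leq_ltn_trans _ lt_s) // -ps size_cat leq_addl.
Qed.

Lemma act_iter_lier n X Y :
  act X (iter n (lier identity_map) Y) = iter n (lier identity_map) (act X Y) +
  \sum_(p < n) 'C(n, p)%:R *: lie (iter p (lier identity_map) Y)
     (iter (n - p).-1 (lier identity_map) X).
Proof.
by rewrite -{3}(act_identity X); apply: derivation_iter_lier (act_lie X).
Qed.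

(** The failure of the derivative along X to commute with c(R).  The index m is
    n - 1, where n is the exponent in c_n R^n. *)
Lemma act_adseries N c X Y s : (size s < N)%N ->
  act X (adseries identity_map c Y) s =
  adseries identity_map c (act X Y) s +
  \sum_(m < N) \sum_(p < m.+1) (c m.+1 * 'C(m.+1, p)%:R) *:
    lie (iter p (lier identity_map) Y) (iter (m - p) (lier identity_map) X) s.
Proof.
move=> lt_s; have T0 : identity_map [::] = 0 by [].
rewrite (@act_agree N X _ (\sum_(n < N.+1) c n *: iter n (lier identity_map) Y)) //;
  last by move=> r lt_r; rewrite (adseries_trunc T0 _ _ lt_r) taylor_sum.
rewrite linear_sum taylor_sum (@adseries_trunc _ _ _ _ T0 N.+1) ?leqW //.
rewrite [X in _ + X](_ : _ = \sum_(n < N.+1) \sum_(p < n)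
    (c n * 'C(n, p)%:R) *: lie (iter p (lier identity_map) Y)
       (iter (n - p).-1 (lier identity_map) X) s); last first.
  rewrite big_ord_recl big_ord0 add0r; apply: eq_bigr => m _.
  rewrite -[nat_of_ord (lift ord0 m)]/(m.+1).
  by apply: eq_bigr => p _; rewrite subSn // -ltnS.
rewrite -big_split; apply: eq_bigr => n _.
rewrite linearZ -[LHS]/(c n *: act X _ s) act_iter_lier.
rewrite -[LHS]/(c n *: (taylor _ s + taylor _ s)) scalerDr.
congr (_ + _).
rewrite taylor_sum scaler_sumr; apply: eq_bigr => p _.
by rewrite -scalerA.
Qed.

Hypothesis charK : [pchar K] =i pred0.

(** The coefficients of (e^z - 1) / z. *)
Definition expm1_coef n : K := (n.+1)`!%:R^-1.

Lemma expm1_coefM m p : (p <= m)%N ->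
  expm1_coef m.+1 * 'C(m.+1, p)%:R + expm1_coef m.+1 * 'C(m.+1, m - p)%:R =
  expm1_coef p * expm1_coef (m - p).
Proof.
move=> le_pm; have fact_neq0 k : k`!%:R != 0 :> K.
  by move/pcharf0P: charK => ->; rewrite -lt0n fact_gt0.
have -> : 'C(m.+1, m - p) = 'C(m.+1, p.+1).
  by rewrite -(@bin_sub m.+1 p.+1) ?subSS.
rewrite -mulrDr -natrD addnC -binS /expm1_coef.
apply: (mulfI (fact_neq0 m.+2)); rewrite mulVKf //.
have <- : ('C(m.+2, p.+1) * (p.+1`! * (m - p).+1`!))%N = m.+2`!.
  by rewrite -(@bin_fact m.+2 p.+1) ?subSS ?subSn // ltnS leqW.
rewrite natrM [(_ * (m - p).+1`!)%:R]natrM -mulrA mulrACA.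
by rewrite !divff // !mulr1.
Qed.

(** The structure equation.  The derivative of the constant E(R) Y along X and that of
    E(R) X along Y vanish, so E(R) [X, Y] is the difference of the two correction terms of
    [act_adseries]; reversing the inner sum of one of them brings it to the same
    brackets as the other, and [expm1_coefM] identifies the total with the Cauchy
    product for [E(R) X, E(R) Y]. *)
Lemma bracket_invariant X Y x y :
  adseries identity_map expm1_coef X = const_map x ->
  adseries identity_map expm1_coef Y = const_map y ->
  adseries identity_map expm1_coef (bracket X Y) = const_map (lie x y).
Proof.
move=> Xx Yy; apply: formal_mapP => s; have T0 : identity_map [::] = 0 by [].
have := act_adseries expm1_coef X Y (ltnSn (size s)).
have := act_adseries expm1_coef Y X (ltnSn (size s)).
rewrite Xx Yy !act_const => EY EX.
rewrite -lie_const_map -Xx -Yy (lie_adseries T0 _ _ _ _ (ltnSn _)).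
rewrite /bracket linearB.
transitivity (adseries identity_map expm1_coef (act X Y) s -
              adseries identity_map expm1_coef (act Y X) s); first by [].
move/esym/eqP: EX; rewrite addr_eq0 => /eqP ->.
move/esym/eqP: EY; rewrite addr_eq0 => /eqP ->.
rewrite opprK addrC -sumrB; apply: eq_bigr => m _.
rewrite [X in _ - X](reindex_inj rev_ord_inj) -sumrB; apply: eq_bigr => p _.
have le_pm : (p <= m)%N by rewrite -ltnS.
have taylorN (f : formal_map h h) : (- f) s = - f s by [].
rewrite [nat_of_ord (rev_ord p)]subSS subKn // [lie (iter (m - p) _ _) _]lieC.
by rewrite taylorN scalerN opprK -scalerDl expm1_coefM.
Qed.
End InvariantFields.

(** * The Bernoulli series in characteristic zero *)

Section Bernoulli.
Variable K : fieldType.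
Hypothesis charK : [pchar K] =i pred0.

Lemma intr_char0_neq0 (d : int) : d != 0 -> d%:~R != 0 :> K.
Proof.
have nz n : n.+1%:R != 0 :> K by move/pcharf0P: charK => ->.
by case: d => [[|n]|n] // _; rewrite ?NegzE ?rmorphN ?oppr_eq0 nz.
Qed.

(** The map ratr is defined by the reduced fraction, which sums and products do not
    respect; allowing any fraction makes it a ring morphism at once. *)
Lemma ratr_char0E (x : rat) (n d : int) :
  d != 0 -> x * d%:~R = n%:~R -> ratr x = n%:~R / d%:~R :> K.
Proof.
move=> d0 xd; apply/eqP; rewrite eqr_div ?intr_char0_neq0 ?denq_neq0 //.
rewrite -!intrM; apply/eqP; congr _%:~R; apply: (@intr_inj rat).
by rewrite !intrM numqE -xd mulrAC.
Qed.

Lemma ratr_char0_zmod_morphism : zmod_morphism (@ratr K).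
Proof.
move=> x y; have [nx ny] := (denq_neq0 x, denq_neq0 y).
rewrite (@ratr_char0E _ (numq x * denq y - numq y * denq x) (denq x * denq y)).
- rewrite intrB !intrM /ratr.
  by field; rewrite !intr_char0_neq0.
- by rewrite mulf_neq0.
- by rewrite intrB !intrM !numqE; ring.
Qed.

Lemma ratr_char0_monoid_morphism : monoid_morphism (@ratr K).
Proof.
split=> [|x y]; first exact: (ratr_nat K 1).
have [nx ny] := (denq_neq0 x, denq_neq0 y).
rewrite (@ratr_char0E _ (numq x * numq y) (denq x * denq y)).
- by rewrite !intrM invfM mulrACA.
- by rewrite mulf_neq0.
- by rewrite !intrM !numqE mulrACA.
Qed.

Definition bernoulli_coef n : K := ratr (bernoulli n) / n`!%:R.

Lemma cauchy_bernoulli n :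
  cauchy_prod bernoulli_coef (expm1_coef K) n = (n == 0)%:R.
Proof.
pose f : {rmorphism rat -> K} := HB.pack (@ratr K)
  (GRing.isZmodMorphism.Build _ _ _ ratr_char0_zmod_morphism)
  (GRing.isMonoidMorphism.Build _ _ _ ratr_char0_monoid_morphism).
have := bernoulli_generating n.+1.
rewrite big_ord_recr /= ltnn mul0r mulr0 addr0 eqSS => /(congr1 f).
rewrite rmorph_sum rmorph_nat => <-; apply: eq_bigr => k _.
rewrite ltn_ord mul1r subSn -1?ltnS // /bernoulli_coef.
by rewrite rmorphM fmorph_div fmorphV !rmorph_nat.
Qed.

Lemma cauchy_prodC c d n : cauchy_prod c d n = cauchy_prod d c n :> K.
Proof.
rewrite /cauchy_prod (reindex_inj rev_ord_inj); apply: eq_bigr => k _ /=.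
by rewrite subSS subKn 1?mulrC // -ltnS.
Qed.
End Bernoulli.

(** * The canonical structure *)

Section CanonicalStructure.
Variables (K : fieldType) (charK : [pchar K] =i pred0).
Variable (h : lieAlgType K).
Let T := @identity_map K h.

Lemma adseries_delta f : adseries T (fun n => (n == 0)%:R) f = f.
Proof.
apply: formal_mapP => s.
rewrite /= /adseries_fun big_ord_recl scale1r big1 ?addr0 // => n _.
by rewrite scale0r.
Qed.

Lemma adseriesK c d :
  (forall n, cauchy_prod c d n = (n == 0)%:R) ->
  cancel (adseries T d) (adseries T c).
Proof.
move=> cd f; rewrite adseries_comp //.
by rewrite (_ : cauchy_prod c d = fun n => (n == 0)%:R) ?adseries_delta //;
  apply/funext.
Qed.

Definition invariant_field x := adseries T (bernoulli_coef K) (const_map x).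

Lemma invariant_field_linear : linear invariant_field.
Proof. by move=> a x y; rewrite /invariant_field const_map_linear linearP. Qed.

(** Both sides have the same image [x, y] under E(R), which b(R) inverts. *)
Lemma invariant_field_bracket x y :
  bracket (invariant_field x) (invariant_field y) = invariant_field (lie x y).
Proof.
have Emap z : adseries T (expm1_coef K) (invariant_field z) = const_map z.
  by apply: adseriesK => n; rewrite cauchy_prodC cauchy_bernoulli.
apply: (can_inj (adseriesK (cauchy_bernoulli charK))).
by rewrite Emap; apply: bracket_invariant.
Qed.

Lemma act_vector_field (X : formal_map h h) :
  @act K h K^o X \in @vector_field_pred K h.
Proof. by apply/asboolP; split; [exact: act_derivation|exists X]. Qed.

Variables (g : lieAlgType K) (phi : lie_hom g h).

Definition canonical_field a :=
  VectorField (act_vector_field (invariant_field (phi a))).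

Lemma canonical_field_linear : linear canonical_field.
Proof.
move=> a x y; apply/val_inj/funext => f /=.
by rewrite lie_hom_linear invariant_field_linear actDl.
Qed.

Lemma canonical_field_lie : {morph canonical_field : x y / lie x y}.
Proof.
move=> x y; apply/val_inj/funext => f /=.
by rewrite lie_hom_lie -invariant_field_bracket act_bracket.
Qed.

Definition canonical_structure : formal_homogeneous_structure g h :=
  LieHom canonical_field_linear canonical_field_lie.
End CanonicalStructure.

(** * Finitely supported linear combinations *)

Section Expansion.
Variables (K : fieldType) (W : lmodType K).

(** The support is witnessed by a list, and it is the coefficients, rather than the
    terms, that vanish outside it: a zero coefficient stays zero when the vectors
    are expanded in turn, which keeps [expansion_comp] free of any hypothesis on
    the vectors. *)
Definition expansion (J : choiceType) (c : J -> K) (v : J -> W) (w : W) :=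
  exists r : seq J, [/\ uniq r, forall j, j \notin r -> c j = 0
                      & w = \sum_(j <- r) c j *: v j].

Lemma expansion0 (J : choiceType) (c : J -> K) v :
  (forall j, c j = 0) -> expansion c v 0.
Proof. by move=> c0; exists [::]; split=> //; rewrite big_nil. Qed.

Lemma expansion_widen (J : choiceType) (c : J -> K) (v : J -> W) (r r' : seq J) :
  uniq r -> uniq r' -> {subset r <= r'} -> (forall j, j \notin r -> c j = 0) ->
  \sum_(j <- r) c j *: v j = \sum_(j <- r') c j *: v j.
Proof.
move=> ur ur' rr' c0.
rewrite [RHS](bigID (mem r)) /= [X in _ + X]big1 => [|j /c0 ->];
  last by rewrite scale0r.
rewrite addr0 -[RHS]big_filter; apply: perm_big; apply: uniq_perm => //.
  by rewrite filter_uniq.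
by move=> j; rewrite mem_filter /=; case jr : (j \in r) => //=; rewrite rr'.
Qed.

Lemma expansion_sum (J : choiceType) (P : eqType) (ps : seq P)
    (c : P -> J -> K) v (w : P -> W) :
  (forall p, p \in ps -> expansion (c p) v (w p)) ->
  expansion (fun j => \sum_(p <- ps) c p j) v (\sum_(p <- ps) w p).
Proof.
elim: ps => [|p ps IH] cw.
  by exists [::]; split=> // [j _|]; rewrite !big_nil.
have [r1 [u1 z1 e1]] := cw p (mem_head _ _).
have [|r2 [u2 z2 e2]] := IH; first by move=> q qps; apply: cw; rewrite inE qps orbT.
exists (undup (r1 ++ r2)); split=> [|j|]; first exact: undup_uniq.
  rewrite mem_undup mem_cat negb_or big_cons => /andP[/z1 -> /z2 ->].
  by rewrite addr0.
under [RHS]eq_bigr do rewrite big_cons scalerDl.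
rewrite big_cons big_split e1 e2 /=; congr (_ + _); apply: expansion_widen => //;
  rewrite ?undup_uniq // => j jr; by rewrite mem_undup mem_cat jr ?orbT.
Qed.

Lemma expansion_comp (J M : choiceType) (c : J -> K) (v : J -> W) w
    (d : J -> M -> K) (u : J -> M -> W) :
  expansion c v w -> (forall j, expansion (d j) (u j) (v j)) ->
  expansion (fun p : J * M => c p.1 * d p.1 p.2) (fun p => u p.1 p.2) w.
Proof.
move=> [r [ur zr ->]] /choice[q qP].
exists [seq (j, m) | j <- r, m <- q j]; split=> [|[j m] jm|].
- apply: allpairs_uniq_dep => // [j _|]; first by have [] := qP j.
  by move=> [j m] [j' m'] _ _ /= [-> ->].
- have [jr|/zr -> /=] := boolP (j \in r); last by rewrite mul0r.
  have [_ zq _] := qP j; rewrite /= zq ?mulr0 //; apply: contra jm => mq.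
  by apply/allpairsPdep; exists j, m.
rewrite big_allpairs_dep /=; apply: eq_bigr => j _.
have [_ _ ->] := qP j; rewrite scaler_sumr; apply: eq_bigr => m _.
by rewrite scalerA.
Qed.

Lemma expansion_reindex (J M : choiceType) (h : J -> M) (c : M -> K) (v : M -> W) w :
  injective h -> (forall m, exists j, h j = m) ->
  expansion (c \o h) (v \o h) w -> expansion c v w.
Proof.
move=> hI hS [r [ur zr ->]]; exists (map h r); split; first by rewrite map_inj_uniq.
  by move=> m; have [j <-] := hS m; rewrite mem_map // => /zr.
by rewrite big_map.
Qed.

Lemma eq_expansion (J : choiceType) (c d : J -> K) (v u : J -> W) w :
  c =1 d -> v =1 u -> expansion c v w -> expansion d u w.
Proof. by move=> /funext -> /funext ->. Qed.

Lemma basis_expansion (I : choiceType) (e : basis W I) w :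
  expansion (fun i => dual e i w) e w.
Proof.
have /finite_seqP[r rP] := dual_finite e w.
have r0 i : i \notin undup r -> dual e i w = 0.
  rewrite mem_undup => ir; apply/eqP/negPn/negP => nz; move/negP: ir; apply.
  by have : [set j | dual e j w != 0]%classic i by []; rewrite rP.
exists (undup r); split; rewrite ?undup_uniq //.
rewrite {1}(dual_span e w) (fsbigE (undup r)) ?undup_uniq //.
  by apply: eq_bigl => i; rewrite in_setT.
by move=> i _ /r0 ->; rewrite scale0r.
Qed.

End Expansion.

HB.instance Definition _ (K : fieldType) (W : lmodType K) (I : choiceType)
    (e : basis W I) i :=
  GRing.isLinear.Build K W K^o *:%R (dual e i) (@dual_linear K W I e i).

Lemma dual_expansion (K : fieldType) (W : lmodType K) (J I : choiceType)
    (e : basis W I) (c : J * I -> K) w i :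
  expansion c (fun p => e p.2) w ->
  expansion (W := K^o) (fun j => c (j, i)) (fun=> 1) (dual e i w).
Proof.
move=> [r [ur zr ->]]; exists [seq p.1 | p <- r & p.2 == i]; split.
- rewrite map_inj_in_uniq ?filter_uniq // => -[j k] [j' k'].
  by rewrite !mem_filter /= => /andP[/eqP -> _] /andP[/eqP -> _] ->.
- move=> j jr; apply: zr; apply: contra jr => jr.
  by apply/mapP; exists (j, i); rewrite // mem_filter eqxx.
transitivity (\sum_(p <- r) c p * dual e i (e p.2)).
  by rewrite linear_sum; apply: eq_bigr => p _; rewrite linearZ.
rewrite big_map big_filter [RHS]big_mkcond; apply: eq_bigr => -[j k] _ /=.
rewrite dual_bvec eq_sym; case: eqP => [->|_]; last by rewrite mulr0.
by rewrite mulr1 [RHS]mulr1.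
Qed.

Lemma expansion_lie (K : fieldType) (h : lieAlgType K) (J M : choiceType)
    (c : J -> K) (d : M -> K) (v : J -> h) (u : M -> h) x y :
  expansion c v x -> expansion d u y ->
  expansion (fun p : J * M => c p.1 * d p.2)
    (fun p => lie (v p.1) (u p.2)) (lie x y).
Proof.
move=> [r [ur zr ->]] [q [uq zq ->]].
exists [seq (j, m) | j <- r, m <- q]; split=> [|[j m] jm|].
- by apply: allpairs_uniq => // -[j m] [j' m'] _ _ /= [-> ->].
- have [jr|/zr -> /=] := boolP (j \in r); last by rewrite mul0r.
  rewrite /= zq ?mulr0 //; apply: contra jm => mq.
  by apply/allpairsP; exists (j, m).
rewrite big_allpairs_dep lie_suml; apply: eq_bigr => j _.
by rewrite lie_sumr; apply: eq_bigr => m _; rewrite lieZl lieZr scalerA.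
Qed.

Lemma fsbig_expansion (K : fieldType) (J : choiceType) (c : J -> K) (w : K) :
  expansion (W := K^o) c (fun=> 1) w ->
  finite_set [set j | c j != 0]%classic /\ w = \sum_(j \in [set: J]) c j.
Proof.
move=> [r [ur zr ->]]; split.
  apply: sub_finite_set (finite_seq r) => j /=; apply: contraNT => /zr ->.
  by rewrite eqxx.
rewrite (fsbigE r) //; last by move=> j _ /zr.
by apply: eq_big => [j|j _]; rewrite ?in_setT // [LHS]mulr1.
Qed.

(** * The formula in coordinates *)

Section Coordinates.
Variables (K : fieldType) (h : lieAlgType K) (I : choiceType) (e : basis h I).
Let T := @identity_map K h.

Definition monomial n (beta : n.-tuple I) : formal_function h :=
  \prod_(k < n) coordinate e (tnth beta k).

(** The chain of structure constants ends at alpha, supplied as the default value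
    of nth for the index just past the end of gamma. *)
Definition structure_product (x : h) alpha n (gamma beta : n.-tuple I) : K :=
  dual e (nth alpha gamma 0) x *
  \prod_(k < n) structure_constant e (nth alpha gamma k) (tnth beta k)
    (nth alpha gamma k.+1).

Lemma monomial_rcons n (beta : n.-tuple I) i s :
  monomial (rcons_tuple beta i) s =
  \sum_(p <- splits s) monomial beta p.1 * coordinate e i p.2.
Proof.
rewrite {1}/monomial big_ord_recr.
set P := \prod_(k < n) _; set c := coordinate e _.
have -> : P = monomial beta.
  apply: eq_bigr => k _; congr (coordinate e _).
  by rewrite !(tnth_nth i) /= nth_rcons size_tuple ltn_ord.
have -> : c = coordinate e i.
  by congr (coordinate e _); rewrite (tnth_nth i) /= nth_rcons size_tuple ltnn eqxx.
by [].
Qed.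

(** Appending a pair (i, j) extends the chain by one link: i becomes the former
    endpoint and j the new argument of the bracket. *)
Lemma structure_product_rcons x alpha n (gamma beta : n.-tuple I) i j :
  structure_product x alpha (rcons_tuple gamma i) (rcons_tuple beta j) =
  structure_product x i gamma beta * structure_constant e i j alpha.
Proof.
have nthE k : (k <= n)%N -> nth alpha (rcons gamma i) k = nth i gamma k.
  rewrite nth_rcons size_tuple leq_eqVlt => /orP[/eqP ->|lt_kn].
    by rewrite ltnn eqxx nth_default ?size_tuple.
  by rewrite lt_kn; apply: set_nth_default; rewrite size_tuple.
rewrite /structure_product big_ord_recr /= nthE // mulrA; congr (_ * _ * _).
  apply: eq_bigr => k _; rewrite (nthE k) 1?ltnW // (nthE k.+1) //.
  by rewrite !(tnth_nth i) /= nth_rcons size_tuple ltn_ord.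
rewrite nthE // nth_default ?size_tuple // (tnth_nth i) /=.
by rewrite !nth_rcons !size_tuple ltnn eqxx ltnNge leqnSn /= gtn_eqF.
Qed.

Lemma rcons_tuple_surj n (t : n.+1.-tuple I) :
  exists t' i, t = rcons_tuple t' i :> n.+1.-tuple I.
Proof.
case: t => t; case/lastP: t => // t i st.
have st' : size t == n by move: st; rewrite size_rcons eqSS.
by exists (Tuple st'), i; apply: val_inj.
Qed.

Lemma coordinate_expansion s : expansion (fun i => coordinate e i s) e (T s).
Proof.
case: s => [|v [|w s]]; [exact: expansion0| |exact: expansion0].
exact: eq_expansion (basis_expansion e v).
Qed.

(** All components of R^n x are expanded together, with the endpoint of the chain
    as a further index p.2: joint finiteness of the support is what the induction
    on n needs, since the next bracket is taken with each basis vector e p.2 and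
    then expanded again.  Recursion is on the last link of the chain, because R is
    applied on the outside. *)
Lemma iter_lier_expansion n x s :
  expansion
    (fun p : n.-tuple I * n.-tuple I * I =>
       structure_product x p.2 p.1.1 p.1.2 * monomial p.1.2 s)
    (fun p => e p.2) (iter n (lier T) (const_map x) s).
Proof.
elim: n s => [|n IH] s.
  pose o := [tuple] : 0.-tuple I.
  apply: (@expansion_reindex _ _ _ _ (fun i => (o, o, i))).
  - by move=> i j [].
  - by move=> [[a b] i]; exists i; rewrite (tuple0 a) (tuple0 b).
  case: s => [|v s]; last first.
    apply: expansion0 => i.
    by rewrite /= /monomial big_ord0 [X in _ * X](_ : _ = 0) ?mulr0.
  apply: eq_expansion (basis_expansion e x) => // i.
  by rewrite /= /structure_product /monomial !big_ord0 mulr1 [RHS]mulr1.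
have step : expansion
   (fun q : (n.-tuple I * n.-tuple I * I) * I =>
      \sum_(p <- splits s) structure_product x q.1.2 q.1.1.1 q.1.1.2 *
         monomial q.1.1.2 p.1 * coordinate e q.2 p.2)
   (fun q => lie (e q.1.2) (e q.2)) (iter n.+1 (lier T) (const_map x) s).
  apply: (@expansion_sum _ _ _ _ (splits s)) => p _.
  exact: expansion_lie (IH p.1) (coordinate_expansion p.2).
have := expansion_comp step (fun q => basis_expansion e (lie (e q.1.2) (e q.2))).
(* The former endpoint and the new argument of the bracket become the last entries
   of gamma and beta; the last component is the new endpoint. *)
pose f (q : (n.-tuple I * n.-tuple I * I * I) * I) :=
  (rcons_tuple q.1.1.1.1 q.1.1.2, rcons_tuple q.1.1.1.2 q.1.2, q.2).
move=> E; apply: (@expansion_reindex _ _ _ _ f).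
- move=> [[[[a b] i] j] k] [[[[a' b'] i'] j'] k'] [].
  by move=> /rcons_inj[/val_inj -> ->] /rcons_inj[/val_inj -> ->] ->.
- move=> [[a b] k].
  have [a' [i ->]] := rcons_tuple_surj a; have [b' [j ->]] := rcons_tuple_surj b.
  by exists (a', b', i, j, k).
apply: eq_expansion E => // -[[[[a b] i] j] k] /=.
rewrite structure_product_rcons monomial_rcons.
rewrite -mulrA [structure_constant _ _ _ _ * _]mulrC mulrA mulr_sumr.
by congr (_ * _); apply: eq_bigr => p _; rewrite mulrA.
Qed.

Lemma monomial_homogeneous n (beta : n.-tuple I) s :
  size s != n -> monomial beta s = 0.
Proof.
elim: n beta s => [|n IH] beta s.
  by rewrite /monomial big_ord0; case: s.
have [b [i ->]] := rcons_tuple_surj beta.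
rewrite monomial_rcons => sn.
rewrite big1_seq // => p /andP[_ /splits_perm /perm_size].
case: p => q [|v [|w r]] /= pr; rewrite ?mulr0 //.
by rewrite IH ?mul0r //; move: sn; rewrite -pr size_cat addn1 eqSS.
Qed.

Lemma iter_lier_homogeneous n x s : size s != n ->
  iter n (lier T) (const_map x) s = 0.
Proof.
move=> sn; have [r [_ _ ->]] := iter_lier_expansion n x s.
by rewrite big1 // => p _; rewrite monomial_homogeneous // mulr0 scale0r.
Qed.

Lemma invariant_field_homogeneous x s :
  invariant_field x s =
  bernoulli_coef K (size s) *: iter (size s) (lier T) (const_map x) s.
Proof.
rewrite /= /adseries_fun big_ord_recr /= big1 ?add0r // => n _.
by rewrite iter_lier_homogeneous ?scaler0 // gtn_eqF.
Qed.

(** At s only the chains of length equal to that of s survive, so the finite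
    support found for this length is a finite support for all lengths. *)
Lemma invariant_field_expansion x alpha s :
  expansion (W := K^o)
    (fun j : {n : nat & (n.-tuple I * n.-tuple I)%type} =>
       bernoulli_coef K (tag j) *
       structure_product x alpha (tagged j).1 (tagged j).2 *
       monomial (tagged j).2 s)
    (fun=> 1) (dual e alpha (invariant_field x s)).
Proof.
have [r [ur zr er]] := dual_expansion alpha (iter_lier_expansion (size s) x s).
pose J n : choiceType := (n.-tuple I * n.-tuple I)%type.
exists [seq Tagged J j | j <- r]; split.
- rewrite map_inj_uniq // => j k /eqP; by rewrite eq_Tagged => /eqP.
- move=> [n j]; have [sn|sn _] := eqVneq (size s) n; last first.
    by rewrite monomial_homogeneous ?mulr0.
  case: n / sn j => j.
  rewrite mem_map; last by move=> j1 j2 /eqP; rewrite eq_Tagged => /eqP.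
  by rewrite -mulrA => /zr /= ->; rewrite mulr0.
rewrite invariant_field_homogeneous.
transitivity (bernoulli_coef K (size s) *:
    dual e alpha (iter (size s) (lier T) (const_map x) s)).
  exact: linearZ.
rewrite er scaler_sumr big_map; apply: eq_bigr => j _.
by rewrite scalerA mulrA.
Qed.
End Coordinates.

(** The component of the vector field along alpha is its action on the coordinate
    t^alpha, that is, dual e alpha of its value. *)
Theorem corollary4p1p2 (K : fieldType) (charK : ([pchar K] =i pred0)%R)
    (g h : lieAlgType K) (phi : lie_hom g h) :
  exists F : formal_homogeneous_structure g h,
    forall (A I : choiceType) (ea : basis g A) (e : basis h I) (a : A) (alpha : I),
      is_formal_sum
        (fun j : {n : nat & (n.-tuple I * n.-tuple I)%type} =>
           bernoulli_term phi ea e a alpha (tagged j).1 (tagged j).2)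
        (F (ea a) (coordinate e alpha)).
Proof.
exists (canonical_structure charK phi) => A I ea e a alpha s.
apply: fsbig_expansion.
have -> : canonical_structure charK phi (ea a) (coordinate e alpha) s =
    dual e alpha (invariant_field (phi (ea a)) s) by exact: rawact_linear_function.
apply: eq_expansion (invariant_field_expansion e (phi (ea a)) alpha s) => // j.
by rewrite /structure_product mulrA.
Qed.
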